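(* Let $W\colon\mathbb{R}\to[0,+\infty)$ be continuous with $W^{-1}(\{0\})=\{-1,1\}$, and suppose there exists $c>0$ such that $W(s)\ge c\,(s-1)^2$ for all $s\ge 0$ and $W(s)\ge c\,(s+1)^2$ for all $s\le 0$. Then there exists a constant $k_0>0$ such that $$k_0\int_a^b (u')^2\,dx \leq \frac{1}{(b-a)^2}\int_a^b W(u)\,dx+(b-a)^2\int_a^b(u'')^2\,dx$$ for every $a,b\in\mathbb{R}$ with $a<b$ and every $u\in W^{2,2}(a,b)$.
   Context: $W^{2,2}(a,b)$ is the usual Sobolev space of functions in $L^2(a,b)$ with weak derivatives $u',u''\in L^2(a,b)$. *)

(* Defs.v *)
From HB Require Import structures.
From mathcomp Require Import all_boot all_order all_algebra.
From mathcomp Require Import all_classical all_reals all_analysis.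

Set Implicit Arguments.
Unset Strict Implicit.
Unset Printing Implicit Defensive.

Import Order.TTheory GRing.Theory Num.Theory.
Import numFieldNormedType.Exports.

Local Open Scope ring_scope.
Local Open Scope classical_set_scope.

(** C_c^oo(a, b), as functions on [R]: the closure of the support is taken in
    [R], so its being inside ]a, b[ keeps it away from [a] and [b]. *)
Definition test_function (R : realType) (a b : R) (phi : R -> R) : Prop :=
  let supp := closure [set x | phi x != 0] in
  [/\ forall (n : nat) (x : R), derivable (derive1n n phi) x 1,
      compact supp & supp `<=` `]a, b[].

(** Elements of L^2(a, b) are represented by Borel functions; since [u] is
    extended by 0, its values outside ]a, b[ are irrelevant. *)
Definition in_L2 (R : realType) (a b : R) (u : R -> R) : Prop :=
  u \_ `]a, b[ \in Lfun (@lebesgue_measure R) 2%:E.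

(** The test integrals are real-valued, so this is meaningful only for [u] and
    [v] locally integrable on ]a, b[; it is used below together with
    [in_L2]. *)
Definition weak_derivative (R : realType) (a b : R) (k : nat) (u v : R -> R) :
    Prop :=
  forall phi : R -> R, test_function a b phi ->
    Rintegral (@lebesgue_measure R) `]a, b[ (fun x => u x * derive1n k phi x) =
    (-1) ^+ k * Rintegral (@lebesgue_measure R) `]a, b[ (fun x => v x * phi x).

(** [u] belongs to W^{2,2}(a, b), and [u1], [u2] represent its weak derivatives
    u', u'' (which are determined by [u] up to a null set). *)
Definition in_W22 (R : realType) (a b : R) (u u1 u2 : R -> R) : Prop :=
  [/\ in_L2 a b u, in_L2 a b u1 & in_L2 a b u2] /\
  weak_derivative a b 1 u u1 /\ weak_derivative a b 2 u u2.

(* Main.v *)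
Require Import Defs.
From HB Require Import structures.
From mathcomp Require Import all_boot all_order all_algebra.
From mathcomp Require Import all_classical all_reals all_analysis.
From mathcomp Require Import measurable_realfun ring lra.

Import Order.TTheory GRing.Theory Num.Theory.
Import numFieldNormedType.Exports.

Local Open Scope ring_scope.
Local Open Scope classical_set_scope.

(** The inequality rests on two facts about a function [u] of W^{2,2}(a, b),
    with L := b - a and T^2 := L * int (u'')^2.

    By Cauchy-Schwarz, |u'(x) - u'(y)| <= T for all x and y.  If |u'| <= 2 T
    throughout, then int (u')^2 <= 4 T^2 L = 4 L^2 int (u'')^2, and the second
    term of the right-hand side is enough.

    Otherwise |u'(x0)| > 2 T for some x0, so that u' stays within T of
    p := u'(x0), and u expands distances by at least l := |p| - T > 0, whereas
    |u'| <= |p| + T <= 3 l.  An expanding function cannot stay close to a given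
    value for long: {|u - 1| < l L / 16} and {|u + 1| < l L / 16} both lie in
    balls of measure L / 4.  On the remaining half of ]a, b[ the growth of [W]
    gives W(u) >= c (l L / 16)^2, so L^-2 int W(u) dominates a multiple of
    l^2 L, hence of int (u')^2.

    These arguments use the values of u and u' only through the identities
    u(y) - u(x) = int_x^y u' and u'(y) - u'(x) = int_x^y u''.  They hold at all
    points x < y outside a null set: [weak_derivative_lebesgue_pt] proves
    f(y) - f(x) = int_x^y g, for g the weak derivative of f, as soon as x and y
    are Lebesgue points of f.  The test functions used there are smooth plateaux
    that tend to a multiple of the indicator of ]x, y] and whose derivatives
    concentrate at x and y.  The exceptional set is harmless in every integral,
    so continuous representatives never have to be introduced. *)

Section singular_perturbation_estimate.
Context {R : realType}.
Local Notation mu := (@lebesgue_measure R).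
Implicit Types (a b x y : R) (f g u : R -> R).

(** * A flat function and its derivatives *)

(** The family t |-> p(1/t) exp(-1/t), extended by 0, is stable under
    derivation; the smoothness of exp(-1/t) is therefore proved for all
    polynomials [p] at once. *)
Definition flat (p : {poly R}) (t : R) : R :=
  if 0 < t then p.[t^-1] * expR (- t^-1) else 0.

(** Each monomial s^n is at most n! exp(s), one term of the exponential
    series. *)
Lemma horner_le_expR (p : {poly R}) :
  exists2 C : R, 0 < C & forall s, 0 <= s -> `|p.[s]| <= C * expR s.
Proof.
exists (1 + \sum_(i < size p) `|p`_i| * i`!%:R).
  by rewrite ltr_wpDr// sumr_ge0// => i _; rewrite mulr_ge0.
move=> s s0; rewrite mulrDl mul1r ler_wpDl ?expR_ge0//.
rewrite horner_coef (le_trans (ler_norm_sum _ _ _))// mulr_suml.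
apply: ler_sum => i _; rewrite normrM -mulrA ler_wpM2l//.
rewrite normrX ger0_norm// -ler_pdivrMl ?ltr0n ?fact_gt0// mulrC.
case: (nat_of_ord i) => [|k].
  by rewrite expr0 fact0 invr1 mulr1 -expR0 ler_expR.
by rewrite (le_trans _ (expR_ge1Dxn k s0))// lerDr.
Qed.

(** Decay of order two at 0 is what differentiability there requires; it is
    [horner_le_expR] for [p * 'X^2] at s = 1/t. *)
Lemma flat_bound (p : {poly R}) :
  exists2 C : R, 0 < C & forall t, `|flat p t| <= C * t ^+ 2.
Proof.
have [C C0 HC] := horner_le_expR (p * 'X^2).
exists C => // t; rewrite /flat; case: ifPn => [t0|_]; last first.
  by rewrite normr0 mulr_ge0 ?sqr_ge0 ?ltW.
have ti0 : 0 <= t^-1 by rewrite invr_ge0 ltW.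
have := HC _ ti0; rewrite hornerM hornerXn normrM (ger0_norm (sqr_ge0 _)).
rewrite exprVn ler_pdivrMr ?exprn_gt0// => pE.
rewrite normrM (ger0_norm (expR_ge0 _)) expRN ler_pdivrMr ?expR_gt0//.
by rewrite mulrAC.
Qed.

Lemma is_derive0_quadratic (f : R -> R) C : f 0 = 0 ->
  (forall t, `|f t| <= C * t ^+ 2) -> is_derive (0 : R) (1 : R) f 0.
Proof.
move=> f0 fC.
have H : (h^-1 *: (f (h *: 1 + 0) - f 0)) @[h --> (0 : R)^'] --> (0 : R).
  apply/cvgrPdist_le => e e0; near=> h.
  rewrite sub0r normrN normrZ f0 subr0 addr0 /GRing.scale/= mulr1.
  have h0 : h != 0 by near: h; exact: nbhs_dnbhs_neq.
  rewrite normfV ler_pdivrMl ?normr_gt0// (le_trans (fC _))//.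
  rewrite -[h ^+ 2]real_normK ?num_real//.
  rewrite expr2 mulrA mulrC ler_wpM2l//.
  have : `|h| <= e / (1 + `|C|).
    by near: h; apply: dnbhs0_le; rewrite divr_gt0// ltr_wpDr.
  rewrite ler_pdivlMr ?ltr_wpDr// => he; apply: le_trans he.
  rewrite mulrC ler_wpM2l//; have := ler_norm C; lra.
apply: DeriveDef.
  by apply/cvg_ex; exists 0.
exact: cvg_lim H.
Unshelve. all: by end_near. Qed.

Lemma is_derive_flat (p : {poly R}) (t : R) :
  is_derive t (1 : R) (flat p) (flat ('X^2 * (p - p^`())) t).
Proof.
have [t0|t0|t0] := ltgtP t 0.
- have -> : flat ('X^2 * (p - p^`())) t = 0.
    by rewrite /flat ltNge (ltW t0).
  apply: (@near_eq_is_derive _ _ _ (cst 0)).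
  near=> x; rewrite /flat ltNge ifF//; apply/negbF/ltW.
  by near: x; exact: lt_nbhsl.
(* the chain rule for t > 0: (1/t)' = - 1/t^2 produces the factor 'X^2 *)
- apply: (@near_eq_is_derive _ _ _
     ((horner p \o (@GRing.inv R)) * (expR \o (-%R \o (@GRing.inv R))))).
  + near=> x; rewrite /flat ifT//; near: x; exact: lt_nbhsr.
  rewrite /flat t0.
  have tn0 : t != 0 by rewrite gt_eqF.
  have Hinv : is_derive t (1:R) (@GRing.inv R) (- t ^- 2).
    apply: (@trigger_derive _ _ _ (- t ^- 2 *: (1 : R))).
      exact: (@is_deriveV _ id).
    by rewrite /GRing.scale/= mulr1.
  apply: is_derive_eq.
  by rewrite /= !hornerE/= /GRing.scale/=; field.
- rewrite t0; have [C C0 HC] := flat_bound p.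
  have f00 q : flat q 0 = 0 by rewrite /flat ltxx.
  by rewrite f00; exact: (is_derive0_quadratic _ C).
Unshelve. all: by end_near. Qed.

(** * Smooth functions and a smooth step *)

(** Recursion on f' (and not on the last derivative taken, as in [derive1n])
    lets the Leibniz and chain rules be iterated by a plain induction. *)
Fixpoint nderivable (n : nat) (f : R -> R) : Prop :=
  if n is n'.+1 then (forall x, derivable f x 1) /\ nderivable n' f^`()
  else True.

Definition smooth (f : R -> R) := forall n, nderivable n f.

Lemma smoothP f :
  smooth f <-> forall n x, derivable (derive1n n f) x 1.
Proof.
split=> [sf n|df n].
  elim: n f sf => [|n IH] f sf x; first by have [] := sf 1%N.
  by rewrite derive1Sn; apply: IH => m; have [] := sf m.+1.
elim: n f df => [//|n IH] f df; split; first exact: (df 0%N).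
by apply: IH => m x; rewrite -derive1Sn; exact: df.
Qed.

Lemma nderivableW n f : nderivable n.+1 f -> nderivable n f.
Proof. by elim: n f => [//|n IH] f [df /IH]. Qed.

Lemma nderivableD n f g :
  nderivable n f -> nderivable n g -> nderivable n (f \+ g).
Proof.
elim: n f g => [//|n IH] f g [df nf] [dg ng]; split.
  by move=> x; exact: (derivableD (df x) (dg x)).
have -> : (f \+ g)^`() = f^`() \+ g^`().
  by apply/funext => x /=; rewrite !derive1E; exact: (deriveD (df x) (dg x)).
exact: IH.
Qed.

Lemma nderivableM n f g :
  nderivable n f -> nderivable n g -> nderivable n (f \* g).
Proof.
elim: n f g => [//|n IH] f g /[dup] /nderivableW nf' [df nf].
move=> /[dup] /nderivableW ng' [dg ng]; split.
  by move=> x; exact: (derivableM (df x) (dg x)).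
have -> : (f \* g)^`() = (f \* g^`()) \+ (g \* f^`()).
  by apply/funext => x /=; rewrite !derive1E; exact: (deriveM (df x) (dg x)).
by apply: nderivableD; exact: IH.
Qed.

Lemma nderivable_comp n f g :
  nderivable n f -> nderivable n g -> nderivable n (f \o g).
Proof.
elim: n f g => [//|n IH] f g [df nf] /[dup] /nderivableW ng' [dg ng]; split.
  move=> x; apply/derivable1_diffP/differentiable_comp; exact/derivable1_diffP.
have -> : (f \o g)^`() = (f^`() \o g) \* g^`().
  by apply/funext => x; rewrite derive1_comp.
by apply: nderivableM => //; exact: IH.
Qed.

Lemma smooth_horner (p : {poly R}) : smooth (horner p).
Proof.
move=> n; elim: n p => [//|n IH] p; split; first exact: derivable_horner.
by rewrite -derivE; exact: IH.
Qed.

Lemma smooth_affine (c d : R) : smooth (fun t => c * t + d).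
Proof.
have -> : (fun t => c * t + d) = horner (c *: 'X + d%:P).
  by apply/funext => t; rewrite !hornerE.
exact: smooth_horner.
Qed.

Lemma smooth_comp f g : smooth f -> smooth g -> smooth (f \o g).
Proof. by move=> sf sg n; exact: nderivable_comp. Qed.

Lemma smooth_derive1 f : smooth f -> smooth f^`().
Proof. by move=> sf n; have [] := sf n.+1. Qed.

Lemma smoothB f g : smooth f -> smooth g -> smooth (f \- g).
Proof.
move=> sf sg; have -> : f \- g = f \+ ((fun t => -1 * t + 0) \o g).
  by apply/funext => x /=; ring.
move=> n; apply: nderivableD => //; apply: nderivable_comp => //.
exact: smooth_affine.
Qed.

Lemma smooth_derivable f x : smooth f -> derivable f x 1.
Proof. by move=> sf; have [] := sf 1%N. Qed.

Lemma smooth_continuous f : smooth f -> continuous f.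
Proof.
move=> sf x; apply/differentiable_continuous/derivable1_diffP.
exact: smooth_derivable.
Qed.

Lemma smooth_flat (p : {poly R}) : smooth (flat p).
Proof.
move=> n; elim: n p => [//|n IH] p; split=> [x|].
  by have [] := is_derive_flat p x.
have -> : (flat p)^`() = flat ('X^2 * (p - p^`())).
  by apply/funext => x; rewrite derive1E; have [_] := is_derive_flat p x.
exact: IH.
Qed.

Definition smooth_step (H : R -> R) (M : R) :=
  [/\ smooth H, forall t, 0 <= H t <= M,
      forall t, t <= 0 -> H t = 0 & forall t, 1 <= t -> H t = M].

(** With h(t) = exp(-1/t) for t > 0 and 0 otherwise, the step is
    h(h(1) - h(1 - t)): the inner argument is nonpositive for t <= 0 and equal to
    h(1) for t >= 1, and it is nondecreasing since [h] is. *)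
Lemma smooth_step_exists : exists H, exists2 M, 0 < M & smooth_step H M.
Proof.
pose h := flat (1 : {poly R}).
have hE t : 0 < t -> h t = expR (- t^-1).
  by move=> t0; rewrite /h /flat t0 hornerE mul1r.
have h0 t : t <= 0 -> h t = 0 by rewrite /h /flat ltNge => ->.
have hge0 t : 0 <= h t.
  have [/h0->//|/hE->] := leP t 0; exact: expR_ge0.
have hgt0 t : 0 < t -> 0 < h t by move=> /hE ->; exact: expR_gt0.
have hle s t : s <= t -> h s <= h t.
  move=> st; have [/h0->//|s0] := leP s 0.
  have t0 := lt_le_trans s0 st.
  by rewrite !hE// ler_expR lerN2 lef_pV2.
pose q t := -1 * (h (-1 * t + 1)) + h 1.
exists (h \o q), (h (h 1)); first by rewrite !hgt0.
split.
- have sh := smooth_flat 1.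
  have sq : smooth q.
    apply: (smooth_comp (fun t => -1 * t + h 1) (fun t => h (-1 * t + 1))).
      exact: smooth_affine.
    exact: (smooth_comp h (fun t => -1 * t + 1) sh (smooth_affine _ _)).
  exact: smooth_comp.
- move=> t /=; rewrite hge0 hle//.
  by have := hge0 (-1 * t + 1); rewrite /q; lra.
- move=> t t0 /=; apply: h0; rewrite /q.
  have : h 1 <= h (-1 * t + 1) by apply: hle; lra.
  lra.
- move=> t t1 /=; rewrite /q (h0 (-1 * t + 1)); last lra.
  by rewrite mulr0 add0r.
Qed.

(** * Rescaling the step *)

(** H((t - x) / e), written as an affine substitution so that
    [smooth_affine] applies; when [H] is a step, its derivative is a kernel of
    mass [M] concentrated on [x, x + e]. *)
Definition rescale (e x : R) (H : R -> R) (t : R) := H (e^-1 * t + (- x / e)).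

Lemma rescaleE e x H t : rescale e x H t = H ((t - x) / e).
Proof. by rewrite /rescale; congr H; ring. Qed.

Lemma smooth_rescale e x H : smooth H -> smooth (rescale e x H).
Proof. by move=> sH; apply: (smooth_comp H) => //; exact: smooth_affine. Qed.

Lemma rescale_derive e x H t : smooth H ->
  (rescale e x H)^`() t = e^-1 * rescale e x H^`() t.
Proof.
move=> sH; have sA := smooth_affine (e^-1) (- x / e).
rewrite derive1_comp; [|exact: smooth_derivable..].
rewrite mulrC; congr (_ * _).
have -> : (fun t => e^-1 * t + - x / e) = horner (e^-1 *: 'X + (- x / e)%:P).
  by apply/funext => s; rewrite !hornerE.
by rewrite -derivE derivD derivZ derivX derivC addr0 !hornerE.
Qed.

Lemma smooth_step_derive0 H M t : smooth_step H M ->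
  (t < 0) || (1 < t) -> H^`() t = 0.
Proof.
move=> [sH Hb H0 H1] /orP[t0|t1].
  rewrite derive1E (@near_eq_derive _ _ _ H (cst 0)) ?derive_cst//.
  near=> s; apply: H0; near: s; exact: lt_le_nbhsl.
rewrite derive1E (@near_eq_derive _ _ _ H (cst M)) ?derive_cst//.
near=> s; apply: H1; near: s; exact: lt_le_nbhsr.
Unshelve. all: by end_near. Qed.

(** The derivative is continuous and vanishes off [0, 1], a compact set. *)
Lemma smooth_step_derive_bounded H M : smooth_step H M ->
  exists2 B, 0 < B & forall t, `|H^`() t| <= B.
Proof.
move=> HM; have [sH _ _ _] := HM.
have cH : {within `[0, 1], continuous (fun t => `|H^`() t|)}.
  apply: continuous_subspaceT => t.
  have /(_ t) := smooth_continuous _ (smooth_derive1 _ sH).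
  exact: cvg_norm.
have [c _ Hc] := EVT_max (@ler01 R) cH.
exists (1 + `|H^`() c|); first by rewrite ltr_wpDr.
move=> t; have [t01|] := boolP (t \in `[0, 1]%R).
  by rewrite (le_trans (Hc t t01))// lerDr.
rewrite in_itv/= negb_and -!ltNge => t01.
by rewrite (smooth_step_derive0 _ _ _ HM t01) normr0 addr_ge0.
Qed.

(** * Averages against a concentrating kernel *)

Lemma integrable_mul_bounded (D : set R) (f h : R -> R) (B : R) :
  measurable D -> mu.-integrable D (EFin \o f) -> measurable_fun D h ->
  (forall x, `|h x| <= B) ->
  mu.-integrable D (EFin \o (fun x => f x * h x)).
Proof.
move=> mD intf mh hB.
have bh : [bounded h x | x in D].
  exists B; split; first exact: num_real.
  by move=> C BC x _; rewrite /= (le_trans (hB x))// ltW.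
exact: (@integrableMl _ _ _ mu D mD _ _ intf mh bh).
Qed.

Lemma integrable_scale (D : set R) (f : R -> R) (k : R) : measurable D ->
  mu.-integrable D (EFin \o f) -> mu.-integrable D (EFin \o (fun x => k * f x)).
Proof. by move=> mD intf; exact: (@integrableZl _ _ _ mu D mD k _ intf). Qed.

Lemma integrable_sub (D : set R) (f g : R -> R) : measurable D ->
  mu.-integrable D (EFin \o f) -> mu.-integrable D (EFin \o g) ->
  mu.-integrable D (EFin \o (fun x => f x - g x)).
Proof.
by move=> mD intf intg; exact: (@integrableB _ _ _ mu D mD _ _ intf intg).
Qed.

Lemma smooth_measurable (D : set R) (h : R -> R) : measurable D -> smooth h ->
  measurable_fun D h.
Proof.
move=> mD sh; apply: measurable_funTS.
by apply: continuous_measurable_fun; exact: smooth_continuous.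
Qed.

Lemma rescale_derive0 (H : R -> R) (M e x t : R) : 0 < e -> smooth_step H M ->
  t \notin `[x, x + e]%R -> (rescale e x H)^`() t = 0.
Proof.
move=> e0 HM; have [sH _ _ _] := HM.
rewrite in_itv/= negb_and -!ltNge => xte.
rewrite rescale_derive// rescaleE (smooth_step_derive0 _ _ _ HM) ?mulr0//.
rewrite ltr_pdivrMr// mul0r subr_lt0 ltr_pdivlMr// mul1r ltrBrDl.
exact: xte.
Qed.

Lemma rescale_derive_bound (H : R -> R) (B e x t : R) : 0 < e -> smooth H ->
  (forall s, `|H^`() s| <= B) -> `|(rescale e x H)^`() t| <= e^-1 * B.
Proof.
move=> e0 sH HB; rewrite rescale_derive// normrM gtr0_norm ?invr_gt0//.
by rewrite ler_wpM2l ?invr_ge0 ?(ltW e0)// rescaleE HB.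
Qed.

Lemma Rintegral_rescale_derive (H : R -> R) (M e x : R) :
  0 < e -> smooth_step H M ->
  Rintegral mu `[x, x + e] (rescale e x H)^`() = M.
Proof.
move=> e0 [sH _ H0 H1]; have sR := smooth_rescale e x H sH.
have xe : x < x + e by rewrite ltrDl.
rewrite /Rintegral (@continuous_FTC2 _ _ (rescale e x H))//.
- rewrite !rescaleE subrr mul0r (addrC x) addrK divff ?gt_eqF//.
  by rewrite (H0 0)// (H1 1)// sube0.
- by apply: continuous_subspaceT; apply: smooth_continuous; exact: smooth_derive1.
- split; first by move=> t _; exact: smooth_derivable.
  + by apply: cvg_at_right_filter; exact: smooth_continuous.
  + by apply: cvg_at_left_filter; exact: smooth_continuous.
Qed.

Lemma davg_integral (F : R -> R) (x r : R) : 0 < r ->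
  (\int[mu]_(t in ball x r) `|F t - F x|%:E = (r *+ 2)%:E * davg F x r)%E.
Proof.
move=> r0; rewrite /davg /iavg muleA.
rewrite lebesgue_measure_ball ?(ltW r0)// inver mulrn_eq0/= (gt_eqF r0) -EFinM.
by rewrite divff ?mul1e// mulrn_eq0/= (gt_eqF r0).
Qed.

(** The kernel has mass [M] and is bounded by [B / e] on [x, x + e], an interval
    contained in a ball of measure 4 e; hence the factor 4 B in front of the mean
    deviation of [F] from [F x]. *)
Lemma mollified_davg (F H : R -> R) (M B x e : R) : 0 < e ->
  mu.-integrable setT (EFin \o F) -> smooth_step H M ->
  (forall t, `|H^`() t| <= B) ->
  (`|Rintegral mu setT (fun t => (F t * derive1 (rescale e x H) t)%R) - M * F x|%:E
   <= (4 * B)%:E * davg F x (2 * e))%E.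
Proof.
move=> e0 intF HM HB; have [sH _ _ _] := HM.
have B0 : 0 <= B := le_trans (normr_ge0 _) (HB 0).
set K := (rescale e x H)^`(); pose I := `[x, x + e]%classic.
have sK : smooth K by apply: smooth_derive1; exact: smooth_rescale.
have mI : measurable I by exact: measurable_itv.
have mF : measurable_fun setT F by apply/measurable_EFinP; exact: measurable_int intF.
have intFI : mu.-integrable I (EFin \o F) by exact: integrableS intF.
have KB t : `|K t| <= e^-1 * B by exact: rescale_derive_bound.
have mK D : measurable D -> measurable_fun D K by move=> ?; exact: smooth_measurable.
have intK : mu.-integrable I (EFin \o K).
  apply: continuous_compact_integrable; first exact: segment_compact.
  by apply: continuous_subspaceT; exact: smooth_continuous.
have intFK : mu.-integrable I (EFin \o (fun t => F t * K t)).
  by apply: (integrable_mul_bounded _ _ _ (e^-1 * B)) => //; exact: mK.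
have intFxK : mu.-integrable I (EFin \o (fun t => F x * K t)).
  exact: integrable_scale.
have -> : Rintegral mu setT (fun t => F t * K t) - M * F x =
    Rintegral mu I (fun t => (F t - F x) * K t).
  have -> : Rintegral mu setT (fun t => F t * K t) =
      Rintegral mu I (fun t => F t * K t).
    rewrite [RHS]Rintegral_mkcond; congr Rintegral; apply/funext => t.
    rewrite patchE; case: ifPn => // /negP tI.
    rewrite /K (rescale_derive0 H M)// ?mulr0//.
    by apply/negP => tI'; apply: tI; rewrite inE.
  rewrite -(Rintegral_rescale_derive H M e x)// mulrC -/K -/I.
  rewrite -RintegralZl// -RintegralB//.
  by apply: eq_Rintegral => t _; rewrite mulrBl.
have intD : mu.-integrable I (EFin \o (fun t => (F t - F x) * K t)).
  have -> : (EFin \o (fun t => (F t - F x) * K t)) =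
      EFin \o (fun t => F t * K t - F x * K t).
    by apply/funext => t /=; rewrite mulrBl.
  exact: integrable_sub.
rewrite EFin_normr_Rintegral//.
have mFxK : measurable_fun I (EFin \o (fun t => (F t - F x) * K t)).
  exact: (measurable_int mu).
apply: (le_trans (@le_abse_integral _ _ _ mu I _ mI mFxK)).
have mFx D : measurable D -> measurable_fun D (fun t => (`|F t - F x|%:E)%E).
  move=> mD; apply/measurable_EFinP; apply: measurableT_comp => //.
  by apply: measurable_funB => //; exact: measurable_funTS.
apply: (@le_trans _ _ (\int[mu]_(t in I) ((e^-1 * B)%:E * `|F t - F x|%:E)))%E.
  apply: ge0_le_integral => //=.
  - by apply/measurable_EFinP; apply: measurableT_comp => //;
      apply/measurable_EFinP; exact: measurable_int intD.
  - by apply: measurable_funeM; exact: mFx.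
  - by move=> t _; rewrite lee_fin normrM mulrC ler_wpM2r.
rewrite ge0_integralZl//; last 2 first.
- exact: mFx.
- by rewrite lee_fin mulr_ge0// invr_ge0 ltW.
apply: (@le_trans _ _ ((e^-1 * B)%:E * \int[mu]_(t in ball x (2 * e)) `|F t - F x|%:E))%E.
  rewrite lee_wpmul2l ?lee_fin ?mulr_ge0 ?invr_ge0 ?(ltW e0)//.
  apply: ge0_subset_integral => //.
  - exact: measurable_ball.
  - by apply: mFx; exact: measurable_ball.
  - move=> t; rewrite /I /= in_itv/= => /andP[xt te].
    by rewrite /ball/= distrC ger0_norm ?subr_ge0//; lra.
rewrite davg_integral ?mulr_gt0// muleA -EFinM.
by rewrite (_ : e^-1 * B * (2 * e *+ 2) = 4 * B)//; field; rewrite gt_eqF.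
Qed.

Lemma mollified_cvg (F H : R -> R) (M x : R) (e_ : R^nat) :
  (forall n, 0 < e_ n) -> e_ n @[n --> \oo] --> (0 : R) ->
  mu.-integrable setT (EFin \o F) -> lebesgue_pt F x -> smooth_step H M ->
  Rintegral mu setT (fun t => F t * derive1 (rescale (e_ n) x H) t)
    @[n --> \oo] --> M * F x.
Proof.
move=> e0 e_0 intF Fx HM.
have [B B0 HB] := smooth_step_derive_bounded _ _ HM.
have : davg F x (2 * e_ n) @[n --> \oo] --> 0%E.
  move/cvge_at_rightP : Fx => /(_ (fun n => 2 * e_ n)); apply; split.
    by move=> n; rewrite mulr_gt0.
  by rewrite -(mulr0 2); apply: cvgM => //; exact: cvg_cst.
move/fine_cvgP => -[davg_fin davg_0].
apply/cvgrPdist_le => eta eta0.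
move/cvgrPdist_le : davg_0 => /(_ (eta / (4 * B))) davg_eta.
have {}davg_eta := davg_eta (divr_gt0 eta0 (mulr_gt0 (ltr0n _ 4) B0)).
near=> n; rewrite distrC -lee_fin.
apply: le_trans (mollified_davg F H M B x (e_ n) (e0 n) intF HM HB) _.
have dfin : davg F x (2 * e_ n) \is a fin_num by near: n.
rewrite -(fineK dfin) -EFinM lee_fin mulrC -ler_pdivlMr ?mulr_gt0//.
apply: le_trans (ler_norm _) _.
rewrite -[X in `|X|]opprK normrN -(sub0r (fine _)).
by near: n.
Unshelve. all: by end_near. Qed.

(** * Weak derivatives and increments *)

(** A smooth approximation of [M] times the indicator of ]x, y], with
    transitions on the intervals [x, x + e] and [y, y + e]. *)
Definition plateau (H : R -> R) (e x y t : R) := rescale e x H t - rescale e y H t.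

Lemma rescale_left (H : R -> R) (M e x t : R) : 0 < e -> smooth_step H M -> t <= x ->
  rescale e x H t = 0.
Proof.
move=> e0 [_ _ H0 _] tx; rewrite rescaleE H0//.
by rewrite ler_pdivrMr// mul0r subr_le0.
Qed.

Lemma rescale_right (H : R -> R) (M e x t : R) : 0 < e -> smooth_step H M -> x + e <= t ->
  rescale e x H t = M.
Proof.
move=> e0 [_ _ _ H1] xt; rewrite rescaleE H1//.
by rewrite ler_pdivlMr// mul1r lerBrDl.
Qed.

Lemma plateau_bound (H : R -> R) (M e x y t : R) : smooth_step H M -> `|plateau H e x y t| <= M.
Proof.
move=> [_ Hb _ _]; rewrite /plateau /rescale ler_norml.
have /andP[] := Hb (e^-1 * t + - x / e); have /andP[] := Hb (e^-1 * t + - y / e).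
lra.
Qed.

Lemma smooth_plateau (H : R -> R) (M e x y : R) : smooth_step H M -> smooth (plateau H e x y).
Proof. by move=> [sH _ _ _]; apply: smoothB; exact: smooth_rescale. Qed.

Lemma plateau_test_function (H : R -> R) (M e a b x y : R) : 0 < e -> smooth_step H M ->
  a < x -> x < y -> y + e < b -> test_function a b (plateau H e x y).
Proof.
move=> e0 HM ax xy yb.
have supp : closure [set t | plateau H e x y t != 0] `<=` `[x, y + e].
  have cl : closed `[x, y + e]%classic by exact: interval_closed.
  rewrite [X in _ `<=` X]((closure_id _).1 cl); apply: closureS.
  move=> t /= pt; rewrite in_itv/=; apply/andP; split; rewrite leNgt.
    apply: contra pt => tx; rewrite /plateau !(rescale_left _ M) ?subrr//.
      by rewrite ltW// (lt_trans tx).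
    exact: ltW.
  apply: contra pt => ty; rewrite /plateau !(rescale_right _ M) ?subrr//.
    exact: ltW.
  by rewrite ltW// (lt_trans _ ty)// ltrD2r.
split.
- by apply/smoothP; exact: smooth_plateau HM.
- apply: (subclosed_compact _ (@segment_compact _ x (y + e)) supp).
  exact: closed_closure.
- move=> t /supp /=; rewrite !in_itv/= => /andP[xt ty].
  by rewrite (lt_le_trans ax xt) (le_lt_trans ty yb).
Qed.

Lemma plateau_cvg (H : R -> R) (M x y t : R) (e_ : R^nat) :
  (forall n, 0 < e_ n) -> e_ n @[n --> \oo] --> (0 : R) -> smooth_step H M ->
  x < y -> \forall n \near \oo, plateau H (e_ n) x y t =
    if (x < t) && (t <= y) then M else 0.
Proof.
move=> e0 e_0 HM xy; rewrite /plateau.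
have [tx|xt] /= := leP t x.
  apply: nearW => n; rewrite !(rescale_left _ M) ?subrr//.
  by rewrite (le_trans tx)// ltW.
have evx : \forall n \near \oo, x + e_ n <= t.
  move/cvgrPdist_le : e_0 => /(_ (t - x)); rewrite subr_gt0 => /(_ xt).
  apply: filterS => n; rewrite sub0r normrN gtr0_norm//; lra.
have [ty|yt] /= := leP t y.
  apply: filterS evx => n xt'.
  by rewrite (rescale_left _ M _ y)// (rescale_right _ M)// subr0.
have evy : \forall n \near \oo, y + e_ n <= t.
  move/cvgrPdist_le : e_0 => /(_ (t - y)); rewrite subr_gt0 => /(_ yt).
  apply: filterS => n; rewrite sub0r normrN gtr0_norm//; lra.
near=> n; rewrite !(rescale_right _ M) ?subrr//; by near: n.
Unshelve. all: by end_near. Qed.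

(** Dominated convergence: at each point the plateaux are eventually constant,
    and [M * |g|] dominates. *)
Lemma plateau_integral_cvg (g H : R -> R) (M a b x y : R) (e_ : R^nat) :
  (forall n, 0 < e_ n) -> e_ n @[n --> \oo] --> (0 : R) -> smooth_step H M ->
  a < x -> x < y -> y < b -> mu.-integrable `]a, b[ (EFin \o g) ->
  Rintegral mu `]a, b[ (fun t => g t * plateau H (e_ n) x y t)
    @[n --> \oo] --> M * Rintegral mu `]x, y] g.
Proof.
move=> e0 e_0 HM ax xy yb intg.
have xyab : `]x, y]%classic `<=` `]a, b[%classic.
  move=> t /=; rewrite !in_itv/= => /andP[xt ty].
  by rewrite (lt_trans ax xt) (le_lt_trans ty yb).
have -> : M * Rintegral mu `]x, y] g =
    Rintegral mu `]a, b[ ((fun t => M * g t) \_ `]x, y]).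
  rewrite -Rintegral_mkcondr setIidr// RintegralZl//.
  exact: integrableS intg.
have intgp n : mu.-integrable `]a, b[
    (EFin \o (fun t => g t * plateau H (e_ n) x y t)).
  apply: (integrable_mul_bounded _ _ _ M) => //.
    by apply: smooth_measurable => //; exact: smooth_plateau HM.
  by move=> t; exact: plateau_bound.
have M0 : 0 <= M.
  by have [_ /(_ 0)/andP[H0 HM0] _ _] := HM; exact: le_trans HM0.
have intMg : mu.-integrable `]a, b[ (EFin \o (fun t => M * `|g t|)).
  by apply: integrable_scale => //; exact: (@integrable_norm _ _ _ mu _ _ intg).
have intlim : mu.-integrable `]a, b[
    (EFin \o ((fun t => M * g t) \_ `]x, y])).
  rewrite -restrict_EFin; apply/integrable_restrict => //; rewrite setIidr//.
  apply: integrable_scale => //; exact: integrableS intg.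
apply: fine_cvg; rewrite fineK; last exact: integrable_fin_num intlim.
apply: (@dominated_cvg _ _ _ mu _ _ _ _ (EFin \o (fun t => M * `|g t|))) => //.
- by move=> n; exact: (measurable_int mu (intgp n)).
- move=> t _; apply: cvg_near_cst.
  have := plateau_cvg H M x y t e_ e0 e_0 HM xy.
  apply: filterS => n ->; rewrite patchE mem_setE in_itv/=.
  by case: ifPn => _; rewrite ?mulr0// mulrC.
- move=> n t _ /=; rewrite lee_fin normrM mulrC ler_wpM2r//.
  exact: plateau_bound.
Qed.

(** Testing the weak derivative against plateaux of width e: the integral of
    [f] against the derivative of the plateau is a difference of averages of [f]
    near [x] and near [y], which tends to M (f x - f y) at Lebesgue points, while
    the integral of [g] against the plateau tends to M int_x^y g. *)
Lemma weak_derivative_lebesgue_pt (f g : R -> R) (a b x y : R) :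
  mu.-integrable `]a, b[ (EFin \o f) -> mu.-integrable `]a, b[ (EFin \o g) ->
  weak_derivative a b 1 f g -> a < x -> x < y -> y < b ->
  lebesgue_pt (f \_ `]a, b[) x -> lebesgue_pt (f \_ `]a, b[) y ->
  f y - f x = Rintegral mu `]x, y] g.
Proof.
move=> intf intg fg ax xy yb fx fy.
have [H [M M0 HM]] := smooth_step_exists; have [sH _ _ _] := HM.
(* widths small enough for the support to stay below b *)
pose e_ n := (b - y) / 2 * n.+1%:R^-1.
have e0 n : 0 < e_ n by rewrite mulr_gt0// ?divr_gt0// subr_gt0.
have e_0 : e_ n @[n --> \oo] --> (0 : R).
  rewrite -(mulr0 ((b - y) / 2)); apply: cvgM; first exact: cvg_cst.
  exact: cvg_harmonic.
have ye n : y + e_ n < b.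
  have : e_ n <= (b - y) / 2.
    by rewrite ler_piMr ?divr_ge0 ?subr_ge0 ?(ltW yb)// invf_le1// ler1n.
  lra.
have intF : mu.-integrable setT (EFin \o (f \_ `]a, b[)).
  rewrite -restrict_EFin; have mab : measurable (`]a, b[%classic : set R) by [].
  exact: ((@integrable_mkcond _ _ _ mu _ (EFin \o f) mab).1 intf).
pose K z n := Rintegral mu setT (fun t =>
  (f \_ `]a, b[) t * derive1 (rescale (e_ n) z H) t).
have Kx : K x n @[n --> \oo] --> M * f x.
  have -> : f x = (f \_ `]a, b[) x.
    by rewrite patchE mem_set//= in_itv/= ax (lt_trans xy yb).
  exact: mollified_cvg.
have Ky : K y n @[n --> \oo] --> M * f y.
  have -> : f y = (f \_ `]a, b[) y.
    by rewrite patchE mem_set//= in_itv/= (lt_trans ax xy) yb.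
  exact: mollified_cvg.
have intK z n : mu.-integrable setT
    (EFin \o (fun t => (f \_ `]a, b[) t * derive1 (rescale (e_ n) z H) t)).
  have [B B0 HB] := smooth_step_derive_bounded _ _ HM.
  apply: (integrable_mul_bounded _ _ _ ((e_ n)^-1 * B)) => //.
    apply: smooth_measurable => //; apply: smooth_derive1; exact: smooth_rescale.
  by move=> t; exact: rescale_derive_bound.
have KE n : K x n - K y n =
    - Rintegral mu `]a, b[ (fun t => g t * plateau H (e_ n) x y t).
  have := fg _ (plateau_test_function H M (e_ n) a b x y (e0 n) HM ax xy (ye n)).
  rewrite expr1 mulN1r => <-.
  rewrite Rintegral_mkcond -RintegralB//; apply: eq_Rintegral => t _.
  have dE : derive1n 1 (plateau H (e_ n) x y) t =
      derive1 (rescale (e_ n) x H) t - derive1 (rescale (e_ n) y H) t.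
    have dr z : derivable (rescale (e_ n) z H) t 1.
      by apply: smooth_derivable; exact: smooth_rescale.
    by rewrite derive1n1 !derive1E; exact: (deriveB (dr x) (dr y)).
  by rewrite !patchE; case: ifPn => _; rewrite ?dE ?mulrBr ?mul0r ?subr0.
have lim1 : K x n - K y n @[n --> \oo] --> - (M * Rintegral mu `]x, y] g).
  under eq_fun do rewrite KE.
  by apply: cvgN; exact: (plateau_integral_cvg g H M a b x y e_ e0 e_0).
have eqM : M * - Rintegral mu `]x, y] g = M * (f x - f y).
  rewrite mulrBr mulrN; apply: (cvg_unique _ lim1); last exact: cvgB.
  exact: norm_hausdorff.
have := mulfI (lt0r_neq0 M0) eqM; lra.
Qed.

(** * The space W^{2,2}(a, b) *)

Lemma lebesgue_measure_oc x y : x < y -> mu `]x, y] = (y - x)%:E.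
Proof. by move=> xy; rewrite lebesgue_measure_itv/= lte_fin xy EFinB. Qed.

Lemma in_L2_sqr_integrable a b f : in_L2 a b f ->
  mu.-integrable `]a, b[ (EFin \o (fun x => f x ^+ 2)).
Proof.
move=> f2; have mab : measurable (`]a, b[%classic : set R) by [].
apply: ((@integrable_mkcond _ _ _ mu _ _ mab).2 _).
rewrite restrict_EFin.
rewrite (_ : _ \_ _ = fun x => (f \_ `]a, b[) x ^+ 2).
  exact: Lfun2_integrable_sqr.
by apply/funext => x; rewrite !patchE; case: ifPn => // _; rewrite expr0n.
Qed.

Lemma in_L2_measurable a b f : in_L2 a b f -> measurable_fun `]a, b[ f.
Proof.
rewrite /in_L2 inE => /andP[+ _]; rewrite inE/= => mf.
by apply/(measurable_restrictT _ _).2.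
Qed.

Lemma integrable_cst_lty (D : set R) (c : R) : measurable D ->
  (mu D < +oo)%E -> mu.-integrable D (EFin \o (fun=> c)).
Proof.
move=> mD muD; apply: (@measurable_bounded_integrable _ _ _ mu) => //.
exists `|c|; split; first exact: num_real.
by move=> C cC x _; rewrite /= ltW.
Qed.

(** On a bounded interval |f| <= 1 + f^2 is integrable. *)
Lemma in_L2_integrable a b f : in_L2 a b f ->
  mu.-integrable `]a, b[ (EFin \o f).
Proof.
move=> f2; have mab : measurable (`]a, b[%classic : set R) by [].
have int1 : mu.-integrable `]a, b[ (EFin \o (fun=> 1 : R)).
  apply: integrable_cst_lty => //.
  by rewrite /= lebesgue_measure_itv/=; case: ifPn => _; rewrite ?ltry.
have int1f : mu.-integrable `]a, b[ (EFin \o (fun x => 1 + f x ^+ 2)).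
  exact: (@integrableD _ _ _ mu _ mab _ _ int1 (in_L2_sqr_integrable _ _ _ f2)).
apply: (@le_integrable _ _ _ mu _ mab _ _ _ _ int1f).
  by apply/measurable_EFinP; exact: in_L2_measurable.
move=> x _ /=; rewrite lee_fin (ger0_norm (addr_ge0 _ (sqr_ge0 _)))//.
by rewrite ler_norml; apply/andP; split; nra.
Qed.

(** The derivative vanishes wherever the function vanishes in a neighbourhood,
    that is, off the closed support. *)
Lemma test_function_derive1 a b (phi : R -> R) :
  test_function a b phi -> test_function a b phi^`().
Proof.
move=> [/smoothP sphi cphi phiab].
have supp : closure [set x | phi^`() x != 0] `<=` closure [set x | phi x != 0].
  have cl := @closed_closure _ [set x | phi x != 0].
  rewrite [X in _ `<=` X]((closure_id _).1 cl); apply: closureS.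
  move=> x /= phix; apply: contrapT => xsupp.
  have : \forall t \near x, (~` closure [set x | phi x != 0]) t.
    by apply: open_nbhs_nbhs; split => //; exact: closed_openC.
  move=> nx; move/eqP: phix; apply.
  rewrite derive1E (@near_eq_derive _ _ _ phi (cst 0)) ?derive_cst//.
  apply: filterS nx => t tsupp; apply: contrapT => /eqP phit.
  by apply: tsupp; exact: subset_closure.
split.
- by apply/smoothP; exact: smooth_derive1.
- by apply: (subclosed_compact _ cphi supp); exact: closed_closure.
- exact: subset_trans supp phiab.
Qed.

(** The derivative of a test function is again a test function, so the first
    order identity for [u] can be tested against it. *)
Lemma weak_derivative_succ a b u u1 u2 :
  weak_derivative a b 1 u u1 -> weak_derivative a b 2 u u2 ->
  weak_derivative a b 1 u1 u2.
Proof.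
move=> wu1 wu2 phi tphi.
have := wu1 _ (test_function_derive1 _ _ _ tphi).
have := wu2 _ tphi.
rewrite /derive1n /= expr1 expr2 mulrNN mulr1 mul1r => -> /eqP.
by rewrite mulN1r eq_sym eqr_oppLR => /eqP ->; rewrite mulN1r.
Qed.

Lemma ae_lebesgue_pt a b f : in_L2 a b f ->
  {ae mu, forall x, lebesgue_pt (f \_ `]a, b[) x}.
Proof.
move=> f2; apply: lebesgue_differentiation.
by apply: integrable_locally => //; exact: in_L2_integrable.
Qed.

(** [G] consists of the common Lebesgue points of [u] and [u1]. *)
Lemma W22_good_points a b u u1 u2 : in_W22 a b u u1 u2 ->
  exists G : set R, [/\ G `<=` `]a, b[,
    {ae mu, forall x, `]a, b[%classic x -> G x},
    forall x y, G x -> G y -> x < y -> u y - u x = Rintegral mu `]x, y] u1 &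
    forall x y, G x -> G y -> x < y -> u1 y - u1 x = Rintegral mu `]x, y] u2].
Proof.
move=> [[u_2 u1_2 u2_2] [wu1 wu2]].
exists [set x | [/\ `]a, b[%classic x, lebesgue_pt (u \_ `]a, b[) x &
                 lebesgue_pt (u1 \_ `]a, b[) x]]; split.
- by move=> x [].
- have := ae_lebesgue_pt _ _ _ u1_2; have := ae_lebesgue_pt _ _ _ u_2.
  apply: filterS2; first exact: (ae_filter_ringOfSetsType mu).
  by move=> x ux u1x abx.
- move=> x y [+ xu _] [+ yu _] xy; rewrite /= !in_itv/= => /andP[ax _] /andP[_ yb].
  by apply: (weak_derivative_lebesgue_pt _ _ a b) => //; exact: in_L2_integrable.
- move=> x y [+ _ xu] [+ _ yu] xy; rewrite /= !in_itv/= => /andP[ax _] /andP[_ yb].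
  apply: (weak_derivative_lebesgue_pt _ _ a b) => //; try exact: in_L2_integrable.
  exact: weak_derivative_succ wu1 wu2.
Qed.

(** With c the mean of [f], this is the integral of 0 <= (f - c)^2. *)
Lemma Rintegral_cauchy_schwarz x y f : x < y ->
  mu.-integrable `]x, y] (EFin \o f) ->
  mu.-integrable `]x, y] (EFin \o (fun t => f t ^+ 2)) ->
  (Rintegral mu `]x, y] f) ^+ 2 <=
  (y - x) * Rintegral mu `]x, y] (fun t => f t ^+ 2).
Proof.
move=> xy intf intf2; have mxy : measurable (`]x, y]%classic : set R) by [].
have l0 : 0 < y - x by rewrite subr_gt0.
set I := Rintegral mu _ f; set J := Rintegral mu _ _.
pose c := I / (y - x).
have intc : mu.-integrable `]x, y] (EFin \o (fun=> c ^+ 2)).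
  by apply: integrable_cst_lty => //=; rewrite lebesgue_measure_oc ?ltry.
have int2 : mu.-integrable `]x, y] (EFin \o (fun t => 2 * c * f t)).
  exact: integrable_scale.
have intl : mu.-integrable `]x, y] (EFin \o (fun t => 2 * c * f t - c ^+ 2)).
  exact: integrable_sub.
have := @le_Rintegral _ _ _ mu _ _ _ mxy intl intf2.
rewrite RintegralB// RintegralZl// Rintegral_cst//= lebesgue_measure_oc//=.
rewrite -/I -/J.
have -> : 2 * c * I - c ^+ 2 * (y - x) = I ^+ 2 / (y - x).
  by rewrite /c; field; rewrite gt_eqF.
rewrite ler_pdivrMr// [J * _]mulrC; apply => t _.
by rewrite -subr_ge0 (_ : _ - _ = (f t - c) ^+ 2) ?sqr_ge0//; ring.
Qed.

Lemma Rintegral_ae_bound x y f (C : R) : x < y -> 0 <= C ->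
  mu.-integrable `]x, y] (EFin \o f) ->
  {ae mu, forall t, `]x, y]%classic t -> `|f t| <= C} ->
  `|Rintegral mu `]x, y] f| <= C * (y - x).
Proof.
move=> xy C0 intf fC; have mxy : measurable (`]x, y]%classic : set R) by [].
rewrite -lee_fin EFin_normr_Rintegral//.
apply: (le_trans (@le_abse_integral _ _ _ mu _ _ mxy (measurable_int mu intf))).
rewrite EFinM -lebesgue_measure_oc//.
apply: (@integral_le_bound _ _ _ mu) => //; first exact: (measurable_int mu).
Qed.

(** * Estimates on the set of good points *)

Lemma subitv_oc_oo a b x y : `]a, b[%classic x -> `]a, b[%classic y ->
  `]x, y]%classic `<=` `]a, b[%classic.
Proof.
rewrite /= !in_itv/= => /andP[ax _] /andP[_ yb] t /=; rewrite !in_itv/=.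
by move=> /andP[xt ty]; rewrite (lt_trans ax xt) (le_lt_trans ty yb).
Qed.

(** Used for f = u' and g = u'': the bound T^2 on squared increments, uniform in
    [x] and [y]. *)
Lemma primitive_oscillation a b f g (G : set R) : G `<=` `]a, b[%classic ->
  in_L2 a b g ->
  (forall x y, G x -> G y -> x < y -> f y - f x = Rintegral mu `]x, y] g) ->
  forall x y, G x -> G y ->
  (f y - f x) ^+ 2 <= (b - a) * Rintegral mu `]a, b[ (fun t => g t ^+ 2).
Proof.
move=> Gab g2 fg x y; wlog xy : x y / x < y => [wlg Gx Gy|Gx Gy].
  have [xy|yx|->] := ltgtP x y; first exact: wlg.
    by rewrite -sqrrN opprB; exact: wlg.
  rewrite subrr expr0n mulr_ge0// ?Rintegral_ge0//; last first.
    by move=> t _; exact: sqr_ge0.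
  have := Gab _ Gy; rewrite /= in_itv/= => /andP[ay yb].
  by rewrite subr_ge0 ltW// (lt_trans ay).
have sub := subitv_oc_oo _ _ _ _ (Gab _ Gx) (Gab _ Gy).
have intg2 := in_L2_sqr_integrable _ _ _ g2.
have intg2' : mu.-integrable `]x, y] (EFin \o (fun t => g t ^+ 2)).
  exact: integrableS intg2.
rewrite fg//; apply: le_trans (Rintegral_cauchy_schwarz _ _ _ xy _ intg2') _.
  by apply: integrableS (in_L2_integrable _ _ _ g2).
apply: ler_pM.
- by rewrite subr_ge0 ltW.
- by apply: Rintegral_ge0 => t _; exact: sqr_ge0.
- have := Gab _ Gx; have := Gab _ Gy; rewrite /= !in_itv/=.
  move=> /andP[_ yb] /andP[ax _]; lra.
- rewrite /Rintegral fine_le//; try exact: integrable_fin_num.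
  apply: ge0_subset_integral => //.
    exact: (measurable_int mu intg2).
  by move=> t _; rewrite lee_fin sqr_ge0.
Qed.

(** A primitive of a function that stays within [T] of the constant [p] differs
    from a linear function of slope [p] by a [T]-Lipschitz one. *)
Lemma primitive_expansion a b f g (G : set R) (p T : R) :
  G `<=` `]a, b[%classic -> in_L2 a b g ->
  {ae mu, forall x, `]a, b[%classic x -> G x} ->
  (forall x y, G x -> G y -> x < y -> f y - f x = Rintegral mu `]x, y] g) ->
  0 <= T -> (forall x, G x -> `|g x - p| <= T) ->
  forall x y, G x -> G y -> (`|p| - T) * `|y - x| <= `|f y - f x|.
Proof.
move=> Gab g2 aeG fg T0 gp x y.
wlog xy : x y / x < y => [wlg Gx Gy|Gx Gy].
  have [xy|yx|->] := ltgtP x y; first exact: wlg.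
    by rewrite distrC [leRHS]distrC; exact: wlg.
  by rewrite !subrr normr0 mulr0.
have sub := subitv_oc_oo _ _ _ _ (Gab _ Gx) (Gab _ Gy).
have mxy : measurable (`]x, y]%classic : set R) by [].
have intg : mu.-integrable `]x, y] (EFin \o g).
  by apply: integrableS (in_L2_integrable _ _ _ g2).
have intp : mu.-integrable `]x, y] (EFin \o (fun=> p)).
  by apply: integrable_cst_lty => //=; rewrite lebesgue_measure_oc ?ltry.
have aegp : {ae mu, forall t, `]x, y]%classic t -> `|g t - p| <= T}.
  move: aeG; apply: filterS; first exact: (ae_filter_ringOfSetsType mu).
  by move=> t tG txy; apply: gp; apply: tG; exact: sub.
have := Rintegral_ae_bound x y (fun t => g t - p) T xy T0
  (integrable_sub _ _ _ mxy intg intp) aegp.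
rewrite RintegralB// Rintegral_cst//= lebesgue_measure_oc//= -fg//.
have yx0 : 0 < y - x by rewrite subr_gt0.
rewrite (gtr0_norm yx0) mulrBl => bound.
have := ler_normB (f y - f x) (f y - f x - p * (y - x)).
rewrite (_ : _ - (_ - p * _) = p * (y - x)); last by ring.
by rewrite normrM (gtr0_norm yx0); lra.
Qed.

(** Two points where [f] is [d]-close to [w] have images less than 2 d apart, so
    they are themselves less than 2 d / l apart; any one of them can serve as the
    centre. *)
Lemma expansion_level_set f (G : set R) (l d w : R) : 0 < l ->
  (forall x y, G x -> G y -> l * `|y - x| <= `|f y - f x|) ->
  exists z, forall x, G x -> `|f x - w| < d -> ball z (2 * d / l) x.
Proof.
move=> l0 fl.
have [[z [Gz fz]]|H] := pselect (exists z, G z /\ `|f z - w| < d); last first.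
  by exists 0 => x Gx fx; exfalso; apply: H; exists x.
exists z => x Gx fx; rewrite /ball/= distrC.
rewrite ltr_pdivlMr// mulrC (le_lt_trans (fl _ _ Gz Gx))//.
rewrite (_ : f x - f z = (f x - w) - (f z - w)); last by ring.
by rewrite (le_lt_trans (ler_normB _ _))// mulrDl mul1r ltrD.
Qed.

Lemma integral_sqr_ae_le a b f (K : R) : a < b -> 0 <= K -> in_L2 a b f ->
  {ae mu, forall x, `]a, b[%classic x -> `|f x| <= K} ->
  (\int[mu]_(x in `]a, b[) (f x ^+ 2)%:E <= (K ^+ 2 * (b - a))%:E)%E.
Proof.
move=> ab K0 f2 fK.
have mab : measurable (`]a, b[%classic : set R) by [].
have intf2 := in_L2_sqr_integrable _ _ _ f2.
have -> : ((K ^+ 2 * (b - a))%:E = (K ^+ 2)%:E * mu `]a, b[)%E.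
  by rewrite lebesgue_measure_itv/= lte_fin ab -EFinB -EFinM.
under eq_integral => x _.
  rewrite -[(f x ^+ 2)%:E]gee0_abs; last by rewrite lee_fin sqr_ge0.
  over.
apply: (@integral_le_bound _ _ _ mu) => //.
- exact: (measurable_int mu intf2).
- by rewrite lee_fin sqr_ge0.
- move: fK; apply: filterS; first exact: (ae_filter_ringOfSetsType mu).
  move=> x fK xab; rewrite gee0_abs lee_fin ?sqr_ge0//.
  by rewrite -[f x ^+ 2]real_normK ?num_real// ler_pXn2r ?nnegrE// fK.
Qed.

(** Two balls of radius (b - a) / 8 have total measure at most (b - a) / 2, so at
    least half of ]a, b[ lies off them. *)
Lemma integral_ge_off_balls a b (h : R -> R) (z1 z2 v : R) : a < b ->
  measurable_fun `]a, b[ h -> (forall x, 0 <= h x) -> 0 <= v ->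
  {ae mu, forall x, `]a, b[%classic x -> ~ ball z1 ((b - a) / 8) x ->
     ~ ball z2 ((b - a) / 8) x -> v <= h x} ->
  ((v * ((b - a) / 2))%:E <= \int[mu]_(x in `]a, b[) (h x)%:E)%E.
Proof.
move=> ab mh h0 v0 hv; have l0 : 0 < b - a by rewrite subr_gt0.
pose D : set R := `]a, b[%classic.
pose B1 : set R := ball z1 ((b - a) / 8); pose B2 : set R := ball z2 ((b - a) / 8).
pose A := D `\` (B1 `|` B2).
have mD : measurable D by exact: measurable_itv.
have mB1 : measurable B1 by exact: measurable_ball.
have mB2 : measurable B2 by exact: measurable_ball.
have mB : measurable (B1 `|` B2) by exact: measurableU.
have mA : measurable A by exact: measurableD.
have AD : A `<=` D by move=> x [].
have muA : (((b - a) / 2)%:E <= mu A)%E.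
  have muD : mu D = (b - a)%:E.
    by rewrite lebesgue_measure_itv/= lte_fin ab EFinB.
  have l8 : 0 <= (b - a) / 8 by rewrite divr_ge0 ?ltW.
  have DAB : (mu D <= mu A + (mu B1 + mu B2))%E.
    apply: (@le_trans _ _ (mu (A `|` (B1 `|` B2)))).
      apply: (@le_measure _ _ _ mu); rewrite ?inE//; first exact: measurableU.
      move=> x Dx; have [Bx|nBx] := pselect ((B1 `|` B2) x); first by right.
      by left.
    apply: le_trans (measureU2 mu mA mB) _; rewrite leeD2l//.
    exact: measureU2.
  move: DAB; rewrite muD !lebesgue_measure_ball// -EFinD.
  have muA_fin : mu A \is a fin_num.
    have muAD : (mu A <= mu D)%E by apply: (@le_measure _ _ _ mu); rewrite ?inE.
    by rewrite ge0_fin_numE// (le_lt_trans muAD)// muD ltry.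
  by rewrite -(fineK muA_fin) -EFinD !lee_fin; lra.
apply: (@le_trans _ _ (\int[mu]_(x in A) (h x)%:E)%E); last first.
  apply: ge0_subset_integral => //; first exact/measurable_EFinP.
  by move=> x _; rewrite lee_fin.
apply: (@le_trans _ _ (\int[mu]_(x in A) (cst v%:E) x)%E).
  by rewrite integral_cst// EFinM lee_wpmul2l// lee_fin.
apply: (@ae_ge0_le_integral _ _ _ mu) => //.
- by move=> x _; rewrite lee_fin.
- by apply/measurable_EFinP; exact: measurable_funS mh.
- move: hv; apply: filterS; first exact: (ae_filter_ringOfSetsType mu).
  by move=> x hv [Dx nB]; rewrite lee_fin hv// => Bx; apply: nB; [left|right].
Qed.

End singular_perturbation_estimate.

(** * The interpolation inequality *)

Theorem lemma3p1 (R : realType) (W : R -> R)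
  (W_continuous : continuous W)
  (W_ge0 : forall s : R, 0 <= W s)
  (W_zeros : W @^-1` [set 0] = [set -1; 1])
  (W_growth : exists2 c : R, 0 < c &
     (forall s : R, 0 <= s -> c * (s - 1) ^+ 2 <= W s) /\
     (forall s : R, s <= 0 -> c * (s + 1) ^+ 2 <= W s)) :
  exists2 k0 : R, 0 < k0 &
    forall (a b : R), a < b ->
    forall u u1 u2 : R -> R, in_W22 a b u u1 u2 ->
    (k0%:E * (\int[lebesgue_measure]_(x in `]a, b[) ((u1 x) ^+ 2)%:E) <=
     ((b - a) ^- 2)%:E * (\int[lebesgue_measure]_(x in `]a, b[) (W (u x))%:E) +
     ((b - a) ^+ 2)%:E * (\int[lebesgue_measure]_(x in `]a, b[) ((u2 x) ^+ 2)%:E))%E.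
Proof.
have [c c0 [Wpos Wneg]] := W_growth.
(* 1 / 4 serves when |u'| <= 2 T; otherwise (3 l)^2 L must be compared with
   c (l L / 16)^2 / (2 L), whence 9 * (2 * 16^2) = 9 * 16 * 32. *)
exists (Num.min (1 / 4) (c / (9 * 16 * 32))).
  by rewrite lt_min !divr_gt0// !mulr_gt0.
move=> a b ab u u1 u2 uW22.
have [[u_2 u1_2 u2_2] _] := uW22.
have [G [Gab aeG uG u1G]] := W22_good_points _ _ _ _ _ uW22.
pose mu := @lebesgue_measure R.
pose S := Rintegral mu `]a, b[ (fun t => u2 t ^+ 2).
set k0 := Num.min _ _.
have k0_ge0 : 0 <= k0 by rewrite le_min !divr_ge0 ?(ltW c0)// !mulr_ge0.
have L0 : 0 < b - a by rewrite subr_gt0.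
have S0 : 0 <= S by apply: Rintegral_ge0 => t _; exact: sqr_ge0.
have I2E : (\int[mu]_(x in `]a, b[) (u2 x ^+ 2)%:E)%E = S%:E.
  by rewrite fineK//; apply: integrable_fin_num => //; exact: in_L2_sqr_integrable.
have IW0 : (0 <= \int[mu]_(x in `]a, b[) (W (u x))%:E)%E.
  by apply: integral_ge0 => x _; rewrite lee_fin.
rewrite -/mu I2E.
pose T := Num.sqrt ((b - a) * S).
have T2 : T ^+ 2 = (b - a) * S by rewrite sqr_sqrtr// mulr_ge0// ltW.
have T0 : 0 <= T by exact: sqrtr_ge0.
have osc x y : G x -> G y -> `|u1 y - u1 x| <= T.
  move=> Gx Gy; rewrite -sqrtr_sqr ler_sqrt; last by rewrite mulr_ge0// ltW.
  exact: (primitive_oscillation a b u1 u2 G).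
have aebound K : (forall x, G x -> `|u1 x| <= K) ->
    {ae mu, forall x, `]a, b[%classic x -> `|u1 x| <= K}.
  move=> GK; move: aeG; apply: filterS; first exact: (ae_filter_ringOfSetsType mu).
  by move=> x xG abx; apply: GK; exact: xG.
have [small|large] := pselect (forall x, G x -> `|u1 x| <= 2 * T).
  have T20 : 0 <= 2 * T by rewrite mulr_ge0.
  have I1 := integral_sqr_ae_le _ _ _ _ ab T20 u1_2 (aebound _ small).
  apply: (@le_trans _ _ ((b - a) ^+ 2 * S)%:E).
    apply: (@le_trans _ _ (k0%:E * ((2 * T) ^+ 2 * (b - a))%:E)%E).
      by rewrite lee_wpmul2l// lee_fin.
    rewrite -EFinM lee_fin exprMn T2.
    have k04 : k0 <= 1 / 4 by rewrite ge_min lexx.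
    have -> : (b - a) ^+ 2 * S = 1 / 4 * (2 ^+ 2 * ((b - a) * S) * (b - a)).
      by field.
    by rewrite ler_wpM2r// !mulr_ge0// ltW.
  by rewrite EFinM leeDr// mule_ge0// lee_fin invr_ge0 sqr_ge0.
have [x0 [Gx0 x0T]] : exists x, G x /\ 2 * T < `|u1 x|.
  apply: contrapT => H; apply: large => x Gx; rewrite leNgt; apply/negP => xT.
  by apply: H; exists x.
pose l := `|u1 x0| - T.
have l0 : 0 < l by rewrite /l; lra.
have expand := primitive_expansion a b u u1 G (u1 x0) T Gab u1_2 aeG uG T0
  (fun x => osc x0 x Gx0).
(* chosen so that the level-set balls have radius (b - a) / 8 *)
pose d := l * (b - a) / 16.
have d0 : 0 <= d by rewrite /d divr_ge0// mulr_ge0// ltW.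
have dl : 2 * d / l = (b - a) / 8 by rewrite /d; field; rewrite gt_eqF.
have [z1] := expansion_level_set u G l d 1 l0 expand.
have [z2] := expansion_level_set u G l d (-1) l0 expand.
rewrite dl => near_m1 near_1.
have Wd s : d <= `|s - 1| -> d <= `|s + 1| -> c * d ^+ 2 <= W s.
  move=> s1 s2; have [s0|s0] := leP 0 s.
    apply: le_trans (Wpos _ s0); rewrite ler_wpM2l// ?(ltW c0)//.
    by rewrite -[leRHS]real_normK ?num_real// ler_pXn2r ?nnegrE.
  apply: le_trans (Wneg _ (ltW s0)); rewrite ler_wpM2l// ?(ltW c0)//.
  by rewrite -[leRHS]real_normK ?num_real// ler_pXn2r ?nnegrE.
have mWu : measurable_fun `]a, b[ (W \o u).
  apply: (measurableT_comp (continuous_measurable_fun W_continuous)).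
  exact: in_L2_measurable.
have IW := integral_ge_off_balls a b (W \o u) z1 z2 (c * d ^+ 2) ab mWu.
have {}IW : ((c * d ^+ 2 * ((b - a) / 2))%:E <=
    \int[mu]_(x in `]a, b[) (W (u x))%:E)%E.
  apply: IW; first by move=> x; exact: W_ge0.
    by rewrite mulr_ge0 ?sqr_ge0// ltW.
  move: aeG; apply: filterS; first exact: (ae_filter_ringOfSetsType mu).
  move=> x xG abx nz1 nz2; have Gx := xG abx.
  apply: Wd; rewrite leNgt; apply/negP => ux.
    by apply: nz1; exact: near_1.
  by apply: nz2; apply: near_m1 => //; rewrite opprK.
have big x : G x -> `|u1 x| <= 3 * l.
  move=> Gx; have := osc x0 x Gx0 Gx.
  have := ler_normD (u1 x0) (u1 x - u1 x0); rewrite subrKC /l; lra.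
have l30 : 0 <= 3 * l by rewrite mulr_ge0// ltW.
have I1 := integral_sqr_ae_le _ _ _ _ ab l30 u1_2 (aebound _ big).
apply: (@le_trans _ _ (((b - a) ^- 2)%:E * (c * d ^+ 2 * ((b - a) / 2))%:E)%E).
  apply: (@le_trans _ _ (k0%:E * ((3 * l) ^+ 2 * (b - a))%:E)%E).
    by rewrite lee_wpmul2l// lee_fin.
  rewrite -!EFinM lee_fin.
  have k0c : k0 <= c / (9 * 16 * 32) by rewrite ge_min lexx orbT.
  have -> : (b - a) ^- 2 * (c * d ^+ 2 * ((b - a) / 2)) =
      c / (9 * 16 * 32) * ((3 * l) ^+ 2 * (b - a)).
    by rewrite /d; field; rewrite gt_eqF.
  by rewrite ler_wpM2r// mulr_ge0 ?sqr_ge0// ltW.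
apply: (@le_trans _ _ (((b - a) ^- 2)%:E *
    \int[mu]_(x in `]a, b[) (W (u x))%:E)%E).
  by rewrite lee_wpmul2l// lee_fin invr_ge0 sqr_ge0.
by rewrite leeDl// -EFinM lee_fin mulr_ge0// sqr_ge0.
Qed.
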